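(* Let $F$ be Richard Thompson's group with generators $x_0, x_1$, and let $\mathcal{C}=\mathcal{C}(F,\{x_0,x_1\})$ be its (right) Cayley graph with respect to the generating set $\{x_0,x_1\}$. Let $\lambda$ be a real number with $\lambda>2.5$. Then for any $\xi\in F$ there exists a $\xi$-related finite set $S\subseteq F$ such that there is a closed path in $\mathcal{C}$ of length strictly less than $\lambda\,\mathrm{Card}(S)$ that visits all vertices of $S$. In particular, $F$ does not have property $TS$.
   Context: Thompson's group $F$ is the group with presentation $\langle x_0,x_1,x_2,\ldots \mid x_jx_i=x_ix_{j+1}\ (i<j)\rangle$; it is generated by $x_0,x_1$. For a group $G$ generated by a finite set $A$, $\mathcal{C}(G,A)$ denotes the right Cayley graph: its vertices are the elements of $G$, and edges join $g$ to $ga$ for $g\in G$, $a\in A$; edges may be traversed in both directions. The length of a path is its number of edges, and a path may repeat vertices and edges. Let $G$ be a group and $\xi\in G$. A subset $S\subseteq G$ is called $\xi$-related if for every $g\in S$ one has $g\xi\in S$ or $g\xi^{-1}\in S$. For a connected graph $\Gamma$ and a finite nonempty set $S$ of its vertices, let $p$ be a shortest closed path in $\Gamma$ that visits each vertex of $S$ at least once, and put $\tau(S)=|p|/\mathrm{Card}(S)$, where $|p|$ is the length of $p$. For $\lambda>0$, the graph $\mathcal{C}(G,A)$ satisfies property $TS(\lambda)$ if there exists $\xi\in G$ such that every nonempty finite $\xi$-related set $S\subseteq G$ satisfies $\tau(S)\ge\lambda$ (with $\tau$ computed in $\mathcal{C}(G,A)$). It satisfies $TS(\infty)$ if it satisfies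 $TS(\lambda)$ for all $\lambda>0$. A finitely generated group $G$ has property $TS$ (the Traveller Salesman Property) if $\mathcal{C}(G,A)$ satisfies $TS(\infty)$ for some finite generating set $A$; this does not depend on the choice of finite generating set, so ''some'' can equivalently be replaced by ''any''. *)

(* Defs.v *)
From HB Require Import structures.
From mathcomp Require Import all_boot all_order all_algebra finmap.
From mathcomp Require Import boolp classical_sets reals.

Set Implicit Arguments.
Unset Strict Implicit.
Unset Printing Implicit Defensive.

Import Order.TTheory GRing.Theory Num.Theory.
Local Open Scope quotient_scope.
Local Open Scope fset_scope.

Section Presentation.
Variable X : choiceType.

(* The letter (x, false) stands for x and (x, true) for its inverse. *)
Definition word := seq (X * bool).

Definition inv_word (w : word) : word :=
  rev [seq (l.1, ~~ l.2) | l <- w].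

Variable rels : word -> word -> Prop.

(* The congruence on words whose quotient is the group < X | rels >, where
   rels l r means that l = r is one of the defining relations. *)
Inductive pres_cong : word -> word -> Prop :=
| PresRefl w : pres_cong w w
| PresSym w1 w2 : pres_cong w1 w2 -> pres_cong w2 w1
| PresTrans w1 w2 w3 : pres_cong w1 w2 -> pres_cong w2 w3 -> pres_cong w1 w3
| PresCancel u x b v : pres_cong (u ++ (x, b) :: (x, ~~ b) :: v) (u ++ v)
| PresRel u l r v : rels l r -> pres_cong (u ++ l ++ v) (u ++ r ++ v).

Definition pres_congb : rel word := fun u v => `[< pres_cong u v >].

Lemma pres_congb_refl : reflexive pres_congb.
Proof. by move=> w; apply/asboolP; exact: PresRefl. Qed.

Lemma pres_congb_sym : symmetric pres_congb.
Proof. by move=> u v; apply/asboolP/asboolP; exact: PresSym. Qed.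

Lemma pres_congb_trans : transitive pres_congb.
Proof. by move=> v u w /asboolP uv /asboolP vw; apply/asboolP/(PresTrans uv). Qed.

Canonical pres_equiv :=
  EquivRel pres_congb pres_congb_refl pres_congb_sym pres_congb_trans.

Definition presented := {eq_quot pres_equiv}.
HB.instance Definition _ := Choice.on presented.
HB.instance Definition _ := EqQuotient.on presented.

Definition pres_mk (w : word) : presented := \pi_presented w.

Lemma pres_mkP u v : pres_mk u = pres_mk v <-> pres_cong u v.
Proof. by split=> [/eqmodP/asboolP|uv] //; apply/eqmodP/asboolP. Qed.

Lemma pres_mkK (g : presented) : pres_mk (repr g) = g.
Proof. exact: reprK. Qed.

Lemma pres_cong_ctx u v a b :
  pres_cong u v -> pres_cong (a ++ u ++ b) (a ++ v ++ b).
Proof.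
elim=> {u v} [w|u v _|u v w _ uv _|u x c v|u l r v lr].
- exact: PresRefl.
- exact: PresSym.
- exact: PresTrans.
- by rewrite -!catA !catA -!(catA (a ++ u)) /=; exact: PresCancel.
- by have := PresRel (a ++ u) (v ++ b) lr; rewrite !catA.
Qed.

Lemma pres_cong_cat u u' v v' :
  pres_cong u u' -> pres_cong v v' -> pres_cong (u ++ v) (u' ++ v').
Proof.
move=> uu' vv'; apply: (@PresTrans _ (u' ++ v)).
  exact: (@pres_cong_ctx _ _ [::] v).
by have := @pres_cong_ctx _ _ u' [::] vv'; rewrite !cats0.
Qed.

Lemma inv_word_cat u v : inv_word (u ++ v) = inv_word v ++ inv_word u.
Proof. by rewrite /inv_word map_cat rev_cat. Qed.

Lemma inv_word_cons l w :
  inv_word (l :: w) = inv_word w ++ [:: (l.1, ~~ l.2)].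
Proof. by rewrite /inv_word /= rev_cons cats1. Qed.

Lemma inv_wordK : involutive inv_word.
Proof.
move=> w; rewrite /inv_word map_rev revK -map_comp -[RHS]map_id.
by apply: eq_map => -[x b] /=; rewrite negbK.
Qed.

Lemma pres_cong_mulV w : pres_cong (w ++ inv_word w) [::].
Proof.
elim: w => [|[x b] w ih]; first exact: PresRefl.
rewrite inv_word_cons /= catA -[(x, b) :: _]/([:: (x, b)] ++ _).
apply: PresTrans (pres_cong_ctx [:: (x, b)] [:: (x, ~~ b)] ih) _.
exact: (PresCancel [::] x b [::]).
Qed.

Lemma pres_cong_Vmul w : pres_cong (inv_word w ++ w) [::].
Proof. by have := pres_cong_mulV (inv_word w); rewrite inv_wordK. Qed.

Lemma pres_cong_inv u v : pres_cong u v -> pres_cong (inv_word u) (inv_word v).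
Proof.
move=> uv; apply: (@PresTrans _ (inv_word u ++ (v ++ inv_word v))).
  rewrite -[X in pres_cong X _]cats0.
  by apply: pres_cong_cat (PresRefl _) _; exact/PresSym/pres_cong_mulV.
apply: (@PresTrans _ (inv_word u ++ (u ++ inv_word v))).
  apply: pres_cong_cat (PresRefl _) _.
  by apply: pres_cong_cat (PresRefl _); exact: PresSym.
rewrite catA; exact: (pres_cong_cat (pres_cong_Vmul u) (PresRefl _)).
Qed.

Definition pres_mul (g h : presented) := pres_mk (repr g ++ repr h).
Definition pres_inv (g : presented) := pres_mk (inv_word (repr g)).

Lemma pres_repr_mk w : pres_cong (repr (pres_mk w)) w.
Proof. by apply/pres_mkP; exact: pres_mkK. Qed.

Lemma pres_mk_cat u v : pres_mul (pres_mk u) (pres_mk v) = pres_mk (u ++ v).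
Proof. by apply/pres_mkP; apply: pres_cong_cat; exact: pres_repr_mk. Qed.

Lemma pres_mk_inv w : pres_inv (pres_mk w) = pres_mk (inv_word w).
Proof. by apply/pres_mkP; apply: pres_cong_inv; exact: pres_repr_mk. Qed.

Fact pres_mulA : associative pres_mul.
Proof.
move=> a b c; rewrite -[a]pres_mkK -[b]pres_mkK -[c]pres_mkK.
by rewrite !pres_mk_cat catA.
Qed.

Fact pres_1mul : left_id (pres_mk [::]) pres_mul.
Proof. by move=> a; rewrite -[a]pres_mkK pres_mk_cat. Qed.

Fact pres_mul1 : right_id (pres_mk [::]) pres_mul.
Proof. by move=> a; rewrite -[a]pres_mkK pres_mk_cat cats0. Qed.

Fact pres_Vmul : left_inverse (pres_mk [::]) pres_inv pres_mul.
Proof.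
move=> a; rewrite -[a]pres_mkK pres_mk_inv pres_mk_cat.
by apply/pres_mkP; exact: pres_cong_Vmul.
Qed.

Fact pres_mulV : right_inverse (pres_mk [::]) pres_inv pres_mul.
Proof.
move=> a; rewrite -[a]pres_mkK pres_mk_inv pres_mk_cat.
by apply/pres_mkP; exact: pres_cong_mulV.
Qed.

HB.instance Definition _ :=
  isGroup.Build presented pres_mulA pres_1mul pres_mul1 pres_Vmul pres_mulV.

End Presentation.

Inductive thompson_rel : word nat -> word nat -> Prop :=
| ThompsonRel i j of (i < j)%N :
    thompson_rel [:: (j, false); (i, false)] [:: (i, false); (j.+1, false)].

Definition thompson : groupType := presented thompson_rel.

Definition thompson_x (i : nat) : thompson :=
  pres_mk thompson_rel [:: (i, false)].

Section Graph.
Variables (V : choiceType) (e : rel V).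

(* The closed path with successive vertices v :: p; its length is size p.
   The library's [cycle] is not used because it has no closed path of length 0
   at a vertex. *)
Definition closed_path (v : V) (p : seq V) : bool :=
  path e v p && (last v p == v).

Definition visits (S : {fset V}) (v : V) (p : seq V) : Prop :=
  {subset S <= v :: p}.

Definition closed_visit_length (S : {fset V}) : set nat :=
  [set n | exists v p, [/\ closed_path v p, visits S v p & size p = n]].

Definition shortest_length (S : {fset V}) : nat :=
  xget 0%N [set n | closed_visit_length S n /\
                    forall m, closed_visit_length S m -> (n <= m)%N].

(* If e is a connected graph then some closed path visits all of S, and the
   default value 0 of [shortest_length] is not used. *)
Definition tau (R : realType) (S : {fset V}) : R :=
  ((shortest_length S)%:R / #|` S|%:R)%R.

End Graph.

Section TravellerSalesman.
Variable G : groupType.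
Local Open Scope group_scope.

Definition generates (A : {fset G}) : Prop :=
  forall H : {pred G}, group_closed H -> {subset A <= H} -> forall g, g \in H.

Definition cayley (A : {fset G}) : rel G :=
  fun g h => [exists a : A, (h == g * val a) || (g == h * val a)].

Definition related (xi : G) (S : {fset G}) : Prop :=
  forall g, g \in S -> g * xi \in S \/ g * xi^-1 \in S.

Definition TS_bound (R : realType) (A : {fset G}) (lambda : R) : Prop :=
  exists xi : G, forall S : {fset G},
    S != fset0 -> related xi S -> (lambda <= tau (cayley A) R S)%R.

Definition TS_infty (R : realType) (A : {fset G}) : Prop :=
  forall lambda : R, (0 < lambda)%R -> TS_bound A lambda.

End TravellerSalesman.

Definition property_TS (R : realType) (G : groupType) : Prop :=
  exists A : {fset G}, generates A /\ TS_infty R A.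

(* Main.v *)
Require Import Defs.
From HB Require Import structures.
From mathcomp Require Import all_boot all_order all_algebra finmap.
From mathcomp Require Import boolp classical_sets reals.
From mathcomp Require Import zify lra.

(** Picture F acting on the right on the unit interval by piecewise linear maps.
    The elements x_1, x_2, ... generate the copy of F supported on [1/2, 1],
    and c = x_0^2 x_1^-1 x_0^-1, a word of length 4, is supported on [0, 1/2].
    An element xi moves the point 1/2 weakly to the right or weakly to the left;
    accordingly x_1 commutes with xi c xi^-1 or with xi^-1 c xi, because the
    supports do not overlap ([commute_conj_left_elt]).  Being related to xi or to
    its inverse is the same condition, so let x_1 commute with b = xi c xi^-1.

    Take H = { x_1^i b^j : 0 <= i, j < n } and S = H u H xi, which is xi-related.
    The key point is that both halves of S are grids of commuting elements
    with a short side: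
    - H is the grid on (x_1, b) at 1, and one step along x_1 costs 1 edge;
    - x_1^i b^j xi = xi c^j (xi^-1 x_1 xi)^i, so H xi is the grid at xi on
      (c, xi^-1 x_1 xi), and one step along c costs 4 edges.
    A boustrophedon walk follows each row once and changes rows n times at
    bounded cost ([tours_grid]), so S is visited in (1 + 4) n^2 + O(n) steps.
    When H and H xi are disjoint, S has 2 n^2 elements, whence the ratio 5/2.
    When they meet, xi lies in the abelian group generated by x_1 and b; then
    H xi is also a grid on (x_1, b), and 2 n^2 + O(n) steps visit at least
    n^2 elements.  That H has n^2 elements is read off the abelianization of F
    ([grid_inj]).

    The statement about 1/2 is proved in the presented group, without the
    action.  Every element is a fraction p q^-1 of positive elements, and a
    positive p splits as h t where conjugation by h sends each x_n, n > 0, to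
    x_{n+l} and t is a word in the x_n with n > l ([positive_split]); l counts
    the carets lying over [0, 1/2].  Comparing the numbers l of p and of q tells
    on which side of 1/2 its image lies ([tail1_conj]).

    For the failure of TS, another finite generating set changes the lengths of
    paths by a bounded factor at most ([tours_change]). *)

Set Implicit Arguments.
Unset Strict Implicit.
Unset Printing Implicit Defensive.

Local Open Scope fset_scope.
Local Open Scope ring_scope.

(** * Walks in a Cayley graph *)

Section Tours.
Variables (G : groupType) (A : {fset G}).
Local Open Scope group_scope.

(** The bound n is an inequality and S may omit visited points, so that walks can
    be concatenated, reversed and weakened without tracking them exactly. *)
Definition tours (v w : G) (n : nat) (S : seq G) : Prop :=
  exists p, [/\ path (cayley A) v p, last v p = w, (size p <= n)%N
              & {subset S <= v :: p}].

Lemma cayleyP g h :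
  reflect (exists2 a, a \in A & h = g * a \/ g = h * a) (cayley A g h).
Proof.
apply: (iffP existsP) => [[a /orP gah]|[a aA gah]].
  by exists (val a); [exact: valP|case: gah => /eqP; [left|right]].
by exists [` aA]; case: gah => ->; rewrite eqxx ?orbT.
Qed.

Lemma cayley_sym : symmetric (cayley A).
Proof. by move=> g h; apply: eq_existsb => a; rewrite orbC. Qed.

Lemma cayley_mull k g h : cayley A (k * g) (k * h) = cayley A g h.
Proof.
apply: eq_existsb => a; rewrite -!mulgA.
by rewrite !(inj_eq (mulgI k)).
Qed.

Lemma tours_sub v w n m S T : (n <= m)%N -> {subset T <= S} ->
  tours v w n S -> tours v w m T.
Proof.
move=> nm TS [p [pp lp sp Sp]]; exists p; split=> //; first exact: leq_trans nm.
by move=> x /TS/Sp.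
Qed.

Lemma tours_refl v : tours v v 0 [:: v].
Proof. by exists [::]; split. Qed.

Lemma tours_cat v u w n m S T :
  tours v u n S -> tours u w m T -> tours v w (n + m) (S ++ T).
Proof.
move=> [p [pp lp sp Sp]] [q [pq lq sq Tq]]; exists (p ++ q); split.
- by rewrite cat_path pp lp.
- by rewrite last_cat lp.
- by rewrite size_cat leq_add.
move=> x; rewrite mem_cat => /orP[/Sp|/Tq]; rewrite -cat_cons mem_cat.
  by move=> ->.
rewrite inE => /predU1P[->|->]; last by rewrite orbT.
by rewrite -lp mem_last.
Qed.

Lemma tours_sym v w n S : tours v w n S -> tours w v n S.
Proof.
move=> [p [pp lp sp Sp]]; exists (rev (belast v p)); split.
- rewrite -lp rev_path (eq_path (e' := cayley A)) // => g h.
  exact: cayley_sym.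
- by case: p {pp sp Sp} lp => //= a p _; rewrite rev_cons last_rcons.
- by rewrite size_rev size_belast.
by move=> x /Sp; rewrite lastI mem_rcons lp !inE mem_rev.
Qed.

Lemma tours_mull g v w n S :
  tours v w n S -> tours (g * v) (g * w) n [seq g * s | s <- S].
Proof.
move=> [p [pp lp sp Sp]]; exists [seq g * s | s <- p]; split.
- elim: p v pp {lp sp Sp} => //= a p IH v /andP[va pa].
  by rewrite cayley_mull va IH.
- by rewrite last_map lp.
- by rewrite size_map.
by move=> _ /mapP[s /Sp sS ->]; rewrite -map_cons map_f.
Qed.

Definition dist_le (g : G) (n : nat) : Prop := tours 1 g n [::].

Lemma dist_le_tours g h n : dist_le h n -> tours g (g * h) n [::].
Proof. by move=> /(tours_mull g); rewrite mulg1. Qed.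

Lemma dist1 : dist_le 1 0.
Proof. by apply: tours_sub (tours_refl 1). Qed.

Lemma distM g h n m : dist_le g n -> dist_le h m -> dist_le (g * h) (n + m).
Proof. by move=> dg dh; exact: (tours_cat dg (dist_le_tours g dh)). Qed.

Lemma distV g n : dist_le g n -> dist_le g^-1 n.
Proof. by move=> /(dist_le_tours g^-1) /tours_sym; rewrite mulVg. Qed.

Lemma distX g n m : dist_le g n -> dist_le (g ^+ m) (m * n).
Proof.
move=> dg; elim: m => [|m IH]; first exact: dist1.
by rewrite expgS mulSn; exact: distM.
Qed.

Lemma dist_gen a : a \in A -> dist_le a 1.
Proof.
move=> aA; exists [:: a]; split=> //=; rewrite andbT.
by apply/cayleyP; exists a; rewrite // mul1g; left.
Qed.

Lemma tours_line g u k n : dist_le u k ->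
  tours g (g * u ^+ n) (n * k) [seq g * u ^+ i | i <- iota 0 n.+1].
Proof.
move=> du; elim: n => [|n IH]; first by rewrite /= mulg1; exact: tours_refl.
have step := tours_cat IH (dist_le_tours (g * u ^+ n) du).
have := tours_cat step (tours_refl (g * u ^+ n * u)).
rewrite -!mulgA -expgSr; apply: tours_sub; first by rewrite addn0 mulSn addnC.
move=> x /mapP[i]; rewrite mem_iota add0n => /andP[_ iltn] ->.
rewrite !mem_cat mem_seq1; move: iltn.
rewrite ltnS leq_eqVlt => /predU1P[->|ilt].
  by rewrite eqxx orbT.
by rewrite (map_f (fun j => g * u ^+ j)) // mem_iota.
Qed.

(** In every use u and v commute, and only the length of u matters to the leading
    term: rows run along u. *)
Definition grid (g u v : G) (n m : nat) : seq G :=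
  [seq g * (u ^+ i * v ^+ j) | i <- iota 0 n, j <- iota 0 m].

Lemma gridP g u v n m x :
  reflect (exists i j, [/\ (i < n)%N, (j < m)%N & x = g * (u ^+ i * v ^+ j)])
          (x \in grid g u v n m).
Proof.
apply: (iffP allpairsP) => [[[i j] /=]|[i [j [ltin ltjm ->]]]].
  by rewrite !mem_iota => -[lti ltj ->]; exists i, j.
by exists (i, j); rewrite !mem_iota.
Qed.

(** Each row is entered at the end where the previous one was left, so no row is
    walked twice; b tells at which end of its row the walk stops. *)
Lemma tours_snake g u v k c n m : commute u v -> dist_le u k -> dist_le v c ->
  exists b : bool, tours g (g * (u ^+ (b * n) * v ^+ m))
                     (m.+1 * (n * k + c)) (grid g u v n.+1 m.+1).
Proof.
move=> uv du dv; elim: m => [|m [b IH]].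
  exists true; rewrite !mul1n mulg1.
  apply: tours_sub (tours_line g n du); first exact: leq_addr.
  move=> x /gridP[i [j [ltin]]]; rewrite ltnS leqn0 => /eqP-> ->.
  by rewrite mulg1; apply/mapP; exists i; rewrite ?mem_iota.
exists (~~ b); have vX i := commuteX2 i m.+1 uv.
have row : tours (g * (u ^+ (b * n) * v ^+ m.+1))
    (g * (u ^+ (~~ b * n) * v ^+ m.+1)) (n * k)
    [seq g * v ^+ m.+1 * u ^+ i | i <- iota 0 n.+1].
  rewrite !vX !mulgA; move: (tours_line (g * v ^+ m.+1) n du).
  move: [seq _ | _ <- _] => r line.
  case: b {IH}; rewrite /= ?mul0n ?mul1n mulg1; last exact: line.
  exact: tours_sym line.
have := tours_cat (tours_cat IH (dist_le_tours _ dv)) (_ : tours _ _ _ _).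
rewrite -!mulgA -expgSr => /(_ _ _ _ row); apply: tours_sub; first by lia.
move=> x /gridP[i [j [lti]]]; rewrite ltnS leq_eqVlt => /predU1P[->|ltj] ->.
  rewrite vX mulgA mem_cat orbC (map_f (fun l => g * v ^+ m.+1 * u ^+ l)) //.
  by rewrite mem_iota.
rewrite 2!mem_cat -orbA; apply/orP; left; apply/gridP.
by exists i, j.
Qed.

(** Walking straight back from the end of the snake to g costs only O(n). *)
Lemma tours_grid g u v k c n : commute u v -> dist_le u k -> dist_le v c ->
  tours g g (k * n ^ 2 + (k + 2 * c) * n) (grid g u v n n).
Proof.
move=> uv du dv; case: n => [|n].
  by apply: tours_sub (tours_refl g) => // x /gridP[i [j []]].
have [b] := tours_snake g n n uv du dv.
set w := u ^+ _ * _ => tr; have dw : dist_le w (n * k + n * c).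
  apply: distM (distX n dv); apply: tours_sub (distX _ du) => //.
  by case: b {tr w}; lia.
apply: tours_sub (tours_cat tr (tours_sym (dist_le_tours g dw))).
  by lia.
by move=> x xg; rewrite mem_cat xg.
Qed.

End Tours.

(** * Thompson's group *)

Section ThompsonGroup.
Local Open Scope group_scope.
Local Notation x := thompson_x.

Lemma thompson_ind (P : thompson -> Prop) :
    P 1 -> (forall g i, P g -> P (g * x i)) ->
    (forall g i, P g -> P (g * (x i)^-1)) ->
  forall g, P g.
Proof.
move=> P1 PM PV g; rewrite -[g]pres_mkK.
elim/last_ind: (repr g) => [|w [i b] IH]; first exact: P1.
rewrite -cats1 -pres_mk_cat; case: b; last exact: PM.
by have := PV _ i IH; rewrite {1}/thompson_x [_^-1]pres_mk_inv.
Qed.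

Lemma thompson_conj i j : (i < j)%N -> x j ^ x i = x j.+1.
Proof.
move=> ij; have xji : x j * x i = x i * x j.+1.
  rewrite /x [LHS]pres_mk_cat [RHS]pres_mk_cat; apply/pres_mkP.
  exact: (PresRel [::] [::] (ThompsonRel ij)).
by rewrite conjgE xji mulKg.
Qed.

(** For c constant on the positive integers, the relations preserve the sum of
    the c-weights of the letters: these are the homomorphisms from F to the
    integers. *)
Section ExponentSum.
Import GRing.Theory.
Variable c : nat -> int.
Hypothesis c_const : forall j, (0 < j)%N -> c j.+1 = c j.
Local Open Scope ring_scope.

Definition expsum_word (w : word nat) : int :=
  \sum_(l <- w) (if l.2 then - c l.1 else c l.1).

Definition expsum (g : thompson) : int := expsum_word (repr g).

Lemma expsum_mk w : expsum (pres_mk thompson_rel w) = expsum_word w.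
Proof.
have cong u v : pres_cong thompson_rel u v -> expsum_word u = expsum_word v.
  rewrite /expsum_word; elim=> {u v} // [u v w' _ -> _ -> //|u i b v|u l r v].
    rewrite !big_cat !big_cons /=; congr (_ + _).
    by case: b => /=; rewrite addrA ?addNr ?subrr add0r.
  case=> i j ij; rewrite !big_cat; congr (_ + (_ + _)).
  rewrite !big_cons !big_nil /= c_const; last exact: leq_ltn_trans ij.
  by rewrite !addr0 addrC.
exact/cong/pres_repr_mk.
Qed.

Lemma expsumM g h : expsum (g * h)%g = expsum g + expsum h.
Proof.
by rewrite {1}[(g * h)%g]/(pres_mul _ _) expsum_mk /expsum_word big_cat.
Qed.

Lemma expsum1 : expsum 1%g = 0.
Proof. by have := expsumM 1%g 1%g; rewrite mulg1; lia. Qed.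

Lemma expsumV g : expsum g^-1%g = - expsum g.
Proof. by have := expsumM g g^-1%g; rewrite mulgV expsum1; lia. Qed.

Lemma expsumX g n : expsum (g ^+ n)%g = expsum g *+ n.
Proof.
by elim: n => [|n IH]; [rewrite expsum1|rewrite expgS expsumM IH mulrS].
Qed.

Lemma expsum_x i : expsum (x i) = c i.
Proof. by rewrite expsum_mk /expsum_word big_seq1. Qed.

End ExponentSum.

(** The subgroup generated by the x_n with n >= k; for k = 1 it consists of the
    elements supported on [1/2, 1]. *)
Inductive tail (k : nat) : thompson -> Prop :=
| Tail1 : tail k 1
| TailX n of (k <= n)%N : tail k (x n)
| TailM g h of tail k g & tail k h : tail k (g * h)
| TailV g of tail k g : tail k g^-1.

Lemma tail_conj k l g h :
  (forall n, (k <= n)%N -> tail l (x n ^ h)) -> tail k g -> tail l (g ^ h).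
Proof.
move=> xh; elim=> [|n /xh //|a b _ IHa _ IHb|a _ IHa].
- by rewrite conj1g; exact: Tail1.
- by rewrite conjMg; exact: TailM.
by rewrite conjVg; exact: TailV.
Qed.

Lemma tail_le k l g : (l <= k)%N -> tail k g -> tail l g.
Proof.
move=> lk tg; rewrite -[g]conjg1; apply: tail_conj tg => n kn.
by rewrite conjg1; apply: TailX; exact: leq_trans kn.
Qed.

Lemma tail_conj_mem k g h : tail k g -> tail k h -> tail k (g ^ h).
Proof. by move=> tg th; apply/TailM/TailM => //; exact: TailV. Qed.

Inductive positive : thompson -> Prop :=
| Positive1 : positive 1
| PositiveMx g i of positive g : positive (g * x i).

Lemma positive_x i : positive (x i).
Proof. by rewrite -[x i]mul1g; apply/PositiveMx/Positive1. Qed.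

Lemma positiveM g h : positive g -> positive h -> positive (g * h).
Proof.
move=> pg; elim=> [|a i _ IH]; first by rewrite mulg1.
by rewrite mulgA; exact: PositiveMx.
Qed.

(** Keeping the numerator of length at most 1 is what lets the next lemma push
    one generator through a whole word of inverses. *)
Lemma gen_fraction j i : exists r s, [/\ (x j)^-1 * x i = r * s^-1,
  r = 1 \/ exists k, r = x k & positive s].
Proof.
case: (ltngtP i j) => [ij|ji|->].
- exists (x i), (x j.+1); split; [|by right; exists i|exact: positive_x].
  by rewrite -(thompson_conj ij) -conjVg conjgE mulVKg.
- exists (x i.+1), (x j); split; [|by right; exists i.+1|exact: positive_x].
  by rewrite -(thompson_conj ji) conjgE -!mulgA mulgV mulg1.
by exists 1, 1; split; [rewrite mulVg invg1 mulg1|left|exact: Positive1].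
Qed.

Lemma positive_fraction q i : positive q -> exists r s,
  [/\ q^-1 * x i = r * s^-1, r = 1 \/ exists k, r = x k & positive s].
Proof.
elim=> [|{}q j _ [r [s [qi r1 ps]]]].
  exists (x i), 1; rewrite invg1 mul1g mulg1.
  by split; [|right; exists i|exact: Positive1].
rewrite invgM -mulgA qi mulgA; case: r1 => [->|[k ->]].
  exists 1, (s * x j); rewrite mulg1 mul1g invgM.
  by split=> //; [left|exact: PositiveMx].
have [r' [s' [-> r1 ps']]] := gen_fraction j k.
by exists r', (s * s'); rewrite invgM mulgA; split=> //; exact: positiveM.
Qed.

Lemma fraction g :
  exists p q, [/\ positive p, positive q & g = p * q^-1].
Proof.
elim/thompson_ind: g => [|g i [p [q [pp pq ->]]]|g i [p [q [pp pq ->]]]].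
- by exists 1, 1; rewrite invg1 mulg1; split=> //; exact: Positive1.
- have [r [s [qi r1 ps]]] := positive_fraction i pq.
  exists (p * r), s; rewrite -!mulgA qi; split=> //.
  case: r1 => [->|[k ->]]; first by rewrite mulg1.
  exact: PositiveMx.
exists p, (x i * q); rewrite invgM mulgA; split=> //.
exact: positiveM (positive_x i) pq.
Qed.

(** Positive elements made of l carets over [0, 1/2] act in this way: they move
    the breakpoints to the right of 1/2 by l places. *)
Definition shifts (l : nat) (h : thompson) : Prop :=
  forall n, (0 < n)%N -> x n ^ h = x (n + l)%N.

(** A new letter x_i either splits one of the l + 1 leaves under [0, 1/2], when
    i <= l, and then the letters of t move past it with their indices raised by
    one; or it acts to the right of them and joins t. *)
Lemma positive_split p : positive p ->
  exists l h t, [/\ p = h * t, shifts l h & tail l.+1 t].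
Proof.
elim=> [|{}p i _ [l [h [t [-> hl tl]]]]].
  exists 0%N, 1, 1; rewrite mulg1; split=> //; last exact: Tail1.
  by move=> n; rewrite addn0 conjg1.
have [il|li] := leqP i l; last first.
  by exists l, h, (t * x i); rewrite mulgA; split=> //; apply/TailM/TailX.
exists l.+1, (h * x i), (t ^ x i); split.
- by rewrite -[RHS]mulgA -conjgC mulgA.
- by move=> n n0; rewrite conjgM hl // addnS thompson_conj //; lia.
by apply: tail_conj tl => n ln; rewrite thompson_conj; [exact: TailX|lia].
Qed.

(** If h has at least as many carets as h', the shift by l brought in by h is
    only partly undone by h', so no index falls below 1. *)
Lemma tail1_conj_le k l h t h' t' : (k <= l)%N ->
    shifts l h -> tail l.+1 t -> shifts k h' -> tail k.+1 t' ->
  forall g, tail 1 g -> tail 1 (g ^ (h * t * (h' * t')^-1)).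
Proof.
move=> kl hl tl hk tk g; rewrite !conjgM invgM conjgM => tg.
have th : tail l.+1 (g ^ h).
  by apply: tail_conj tg => n n0; rewrite hl //; apply: TailX; lia.
have: tail k.+1 (((g ^ h) ^ t) ^ t'^-1).
  by apply: (tail_conj_mem _ (TailV tk)); apply/(@tail_le l.+1)/tail_conj_mem.
apply: tail_conj => n kn; have -> : n = (n - k + k)%N by lia.
by rewrite -hk ?conjgK; [apply: TailX|]; lia.
Qed.

(** The two cases say that 1/2 is moved weakly to the right by xi, or by its
    inverse. *)
Lemma tail1_conj xi :
  (forall g, tail 1 g -> tail 1 (g ^ xi)) \/
  (forall g, tail 1 g -> tail 1 (g ^ xi^-1)).
Proof.
have [p [q [/positive_split[l [h [t [-> hl tl]]]]]]] := fraction xi.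
move=> /positive_split[k [h' [t' [-> hk tk]]]] ->.
have [kl|/ltnW lk] := leqP k l; [left|right].
  exact: (tail1_conj_le kl hl tl hk tk).
by rewrite invgM invgK; exact: (tail1_conj_le lk hk tk hl tl).
Qed.

(** The shortness of this word is where the constant 5 = 1 + 4 comes from; the
    element is supported on [0, 1/2]. *)
Definition left_elt : thompson := x 0 * x 0 * (x 1)^-1 * (x 0)^-1.

Lemma left_elt_commute g : tail 1 g -> commute left_elt g.
Proof.
elim=> [|n n0|a b _ ca _ cb|a _ ca]; first exact: commute1.
- rewrite /commute [RHS]conjgC; congr (_ * _); rewrite /left_elt !conjgM.
  rewrite !thompson_conj // -(@thompson_conj 1 n.+1) // conjgK.
  by rewrite -(thompson_conj n0) conjgK.
- exact: commuteM.
exact: commuteV.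
Qed.

Lemma commute_conj_left_elt xi :
  commute (x 1) (left_elt ^ xi^-1) \/ commute (x 1) (left_elt ^ xi).
Proof.
have xc u v : commute left_elt (u ^ v) -> commute u (left_elt ^ v^-1).
  move=> uv; apply: commute_sym.
  by rewrite /commute -{1 2}[u](conjgK v) -!conjMg uv.
case: (tail1_conj xi) => tx; [left|right]; last rewrite -[xi]invgK;
  by apply/xc/left_elt_commute/tx/TailX.
Qed.

End ThompsonGroup.

(** * The set S and its closed path *)

Section ThompsonTour.
Local Open Scope group_scope.
Local Notation x := thompson_x.
Local Notation A := [fset x 0; x 1].

Lemma cayley_connected g : exists n, dist_le A g n.
Proof.
have dx i : exists n, dist_le A (x i) n.
  elim: i => [|[|i] [n dn]].
  - by exists 1%N; apply: dist_gen; rewrite !inE eqxx.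
  - by exists 1%N; apply: dist_gen; rewrite !inE eqxx orbT.
  have d0 : dist_le A (x 0) 1 by apply: dist_gen; rewrite !inE eqxx.
  exists (1 + (n + 1))%N; rewrite -(@thompson_conj 0 i.+1) //.
  by rewrite conjgE; apply: distM (distV d0) (distM dn d0).
elim/thompson_ind: g => [|g i [n dg]|g i [n dg]].
- by exists 0%N; exact: dist1.
- by have [m dm] := dx i; exists (n + m)%N; exact: distM.
by have [m dm] := dx i; exists (n + m)%N; apply: distM (distV dm).
Qed.

Lemma dist_left_elt : dist_le A left_elt 4.
Proof.
have d0 : dist_le A (x 0) 1 by apply: dist_gen; rewrite !inE eqxx.
have d1 : dist_le A (x 1) 1 by apply: dist_gen; rewrite !inE eqxx orbT.
exact: distM (distM (distM d0 d0) (distV d1)) (distV d0).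
Qed.

(** In the abelianization x_1 has coordinates (0, 1) and every conjugate of
    [left_elt] has coordinates (1, -1), so i and j can be recovered. *)
Lemma grid_inj xi :
  let f i j := x 1 ^+ i * (left_elt ^ xi^-1) ^+ j in
  forall i j i' j', f i j = f i' j' -> i = i' /\ j = j'.
Proof.
move=> f i j i' j' ff.
pose c0 k : int := (k == 0%N)%:R%R; pose c1 k : int := (k != 0%N)%:R%R.
have c0S k : (0 < k)%N -> c0 k.+1 = c0 k by case: k.
have c1S k : (0 < k)%N -> c1 k.+1 = c1 k by case: k.
have e0 a b : expsum c0 (f a b) = b%:Z.
  rewrite /f /left_elt conjgE !(expsumM, expsumX, expsumV, expsum_x) // /c0 /=.
  lia.
have e1 a b : expsum c1 (f a b) = (a%:Z - b%:Z)%R.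
  rewrite /f /left_elt conjgE !(expsumM, expsumX, expsumV, expsum_x) // /c1 /=.
  lia.
have := e0 i j; have := e1 i j; rewrite ff e0 e1; lia.
Qed.

(** Right translation by h turns a grid at 1 into a left translate by h of the
    conjugate grid.  The sides are swapped so that rows run along [v ^ h]. *)
Lemma grid_conj (u v h : thompson) n : commute u v ->
  {subset [seq g * h | g <- grid 1 u v n n] <= grid h (v ^ h) (u ^ h) n n}.
Proof.
move=> uv _ /mapP[_ /gridP[i [j [lti ltj ->]]] ->]; apply/gridP.
exists j, i; split=> //; rewrite mul1g -!conjXg -conjMg -conjgC.
by rewrite (commuteX2 i j uv).
Qed.

(** The lower bound on the cardinality is what makes the error term [d * n.+1]
    negligible when n grows. *)
Lemma tour_near_grids xi : commute (x 1) (left_elt ^ xi^-1) ->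
  exists d, forall n, exists (S : {fset thompson}) (p : seq thompson),
    [/\ related xi S, closed_path (cayley A) 1 p, visits S 1 p,
        (n ^ 2 <= #|` S|)%N & (2 * size p <= 5 * #|` S| + d * n.+1)%N].
Proof.
set a := x 1; set b := left_elt ^ xi^-1 => ab.
have [cb db] := cayley_connected b.
have [ca da] := cayley_connected (a ^ xi).
have [e dxi] := cayley_connected xi.
have d1 : dist_le A a 1 by apply: dist_gen; rewrite !inE eqxx orbT.
exists (2 * (5 + 4 * cb + 2 * ca) + 4 * e)%N => n.
pose H := grid 1 a b n n; pose Hxi := [seq h * xi | h <- H].
pose S := [fset g in H ++ Hxi].
have inS g : (g \in S) = (g \in H) || (g \in Hxi).
  by rewrite /S in_fset /= mem_cat.
have relS : related xi S.
  move=> g; rewrite !inS => /orP[gH|/mapP[h hH ->]].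
    by left; rewrite (map_f (fun h => h * xi)) ?orbT.
  by right; rewrite mulgK hH.
have uniqH : uniq H.
  apply: allpairs_uniq; rewrite ?iota_uniq // => -[i j] [i' j'] _ _ /=.
  by rewrite !mul1g => /grid_inj[-> ->].
have sizeH : size H = (n ^ 2)%N by rewrite size_allpairs !size_iota.
have leS : (n ^ 2 <= #|` S|)%N.
  rewrite card_fseq -sizeH; apply: uniq_leq_size => // h hH.
  by rewrite mem_undup mem_cat hH.
have tourS m : tours A xi xi m Hxi ->
    tours A 1 1 (1 * n ^ 2 + (1 + 2 * cb) * n + (e + m + e)) (H ++ Hxi).
  move=> tm; apply: tours_cat; first exact: tours_grid.
  apply: tours_sub (tours_cat (tours_cat dxi tm) (tours_sym dxi)) => // g.
  by rewrite cats0.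
suff [m [tm lem]] : exists m, tours A xi xi m Hxi /\
   (2 * m <= 5 * #|` S| - 2 * n ^ 2 + 2 * (4 + 2 * cb + 2 * ca) * n)%N.
  have [p [pp lp sp Sp]] := tourS _ tm.
  exists S, p; split=> //; first by rewrite /closed_path pp lp eqxx.
    by move=> g; rewrite inS -mem_cat => /Sp.
  rewrite -!mulnn in leS lem sp *; nia.
(* If H and H xi meet, xi is a quotient of two elements of the abelian group
   generated by a and b, hence centralizes both. *)
have [/hasP[_ /mapP[h hH ->] hxiH]|disj] := boolP (has (mem H) Hxi).
  have abxi : a ^ xi = a /\ b ^ xi = b.
    move: hH hxiH => /gridP[i [j [_ _ ->]]] /gridP[i' [j' [_ _]]].
    rewrite !mul1g => /(canRL (mulKg _)) ->.
    have aux u : commute u a -> commute u b ->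
        u ^ ((a ^+ i * b ^+ j)^-1 * (a ^+ i' * b ^+ j')) = u.
      move=> ua ub; rewrite conjgE; apply: (canLR (mulKg _)).
      by apply/commuteM/commuteM; [apply/commuteV/commuteM| |];
        exact: commuteX.
    by split; apply: aux => //; exact: commute_sym.
  have t := tours_grid xi n ab d1 db.
  exists (1 * n ^ 2 + (1 + 2 * cb) * n)%N; split.
    apply: tours_sub t => //.
    move=> _ /mapP[_ /gridP[i [j [lti ltj ->]]] ->]; apply/gridP.
    exists i, j; split=> //; rewrite mul1g.
    by rewrite -{2}abxi.1 -{2}abxi.2 -!conjXg -conjMg -conjgC.
  rewrite -!mulnn in leS *; nia.
have cardS : #|` S| = (2 * n ^ 2)%N.
  rewrite card_fseq undup_id ?size_cat ?size_map ?sizeH ?addnn ?mul2n //.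
  by rewrite cat_uniq uniqH disj map_inj_uniq //; exact: mulIg.
have bxi : b ^ xi = left_elt by rewrite conjgKV.
have ba' : commute (b ^ xi) (a ^ xi) by rewrite /commute -!conjMg ab.
have db' : dist_le A (b ^ xi) 4 by rewrite bxi; exact: dist_left_elt.
exists (4 * n ^ 2 + (4 + 2 * ca) * n)%N; split; last by rewrite cardS; lia.
by apply: tours_sub (tours_grid xi n ba' db' da) => //; exact: grid_conj.
Qed.

End ThompsonTour.

(** * Change of generators and the theorem *)

Section ChangeOfGenerators.
Variables (G : groupType) (A B : {fset G}).
Local Open Scope group_scope.

Lemma generates_dist g : generates A -> exists n, dist_le A g n.
Proof.
move=> genA; pose H : {pred G} := fun h => `[< exists n, dist_le A h n >].
apply/asboolP; apply: (genA H).
  split; first by apply/asboolP; exists 0%N; exact: dist1.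
  move=> h k /asboolP[n dh] /asboolP[m dk]; apply/asboolP.
  by exists (n + m)%N; apply: distM dh (distV dk).
by move=> a aA; apply/asboolP; exists 1%N; exact: dist_gen.
Qed.

Lemma tours_change K v p : (forall b, b \in B -> dist_le A b K) ->
  path (cayley B) v p -> tours A v (last v p) (K * size p) (v :: p).
Proof.
move=> dB; elim: p v => [|w p IH] v /= => [_|/andP[vw /IH wp]].
  exact: tours_sub (tours_refl A v).
have step : tours A v w K [::].
  case/cayleyP: vw => b /dB db [->|->]; first exact: dist_le_tours.
  exact/tours_sym/dist_le_tours.
have := tours_cat (tours_refl A v) (tours_cat step wp).
by apply: tours_sub; rewrite ?mulnS.
Qed.

End ChangeOfGenerators.

(** The minimum exists as soon as some closed path visits S, so the default value
    of the choice operator does not interfere. *)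
Lemma shortest_length_le (V : choiceType) (e : rel V) (S : {fset V}) n :
  closed_visit_length e S n -> (shortest_length e S <= n)%N.
Proof.
move=> en; rewrite /shortest_length.
have ex : exists n, `[< closed_visit_length e S n >].
  by exists n; apply/asboolP.
case: xgetP => [m _ [_]|]; first exact.
case: (ex_minnP ex) => m /asboolP em mmin /(_ m)[]; split=> // k ek.
by apply: mmin; apply/asboolP.
Qed.

Import Order.TTheory GRing.Theory Num.Theory.

Theorem theorem1 (R : realType) :
  (forall lambda : R, 5 / 2 < lambda ->
     forall xi : thompson, exists S : {fset thompson},
       related xi S /\
       exists (v : thompson) (p : seq thompson),
         [/\ closed_path (cayley [fset thompson_x 0; thompson_x 1]) v p,
             visits S v p &
             (size p)%:R < lambda * #|` S|%:R])
  /\ ~ property_TS R thompson.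
Proof.
have short (lambda : R) : 5 / 2 < lambda -> forall xi : thompson,
    exists S : {fset thompson}, related xi S /\
      exists (v : thompson) (p : seq thompson),
        [/\ closed_path (cayley [fset thompson_x 0; thompson_x 1]) v p,
            visits S v p & (size p)%:R < lambda * #|` S|%:R].
  move=> lam xi; wlog comm : xi /
      commute (thompson_x 1) (conjg left_elt (xi^-1)%g).
    move=> H; have [/H//|] := commute_conj_left_elt xi.
    rewrite -{1}[xi]invgK => /H[S [rS path]]; exists S; split=> // g gS.
    by case: (rS g gS); rewrite ?invgK; [right|left].
  have [d dP] := tour_near_grids comm.
  (* Large enough for d (n + 1) <= 2 d n < (2 lambda - 5) n^2, which bounds the
     error term by the excess of 2 lambda over 5. *)
  pose n := (Num.bound (2 * d%:R / (2 * lambda - 5))).+1.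
  have [S [p [rS cp vS nS pS]]] := dP n; exists S; split=> //.
  exists 1%g, p; split=> //.
  have del : 0 < 2 * lambda - 5 by lra.
  have nbig : 2 * d%:R < n%:R * (2 * lambda - 5).
    rewrite -ltr_pdivrMr // (lt_trans (archi_boundP _)) ?ltr_nat //.
    by rewrite divr_ge0 ?mulr_ge0 ?ler0n // ltW.
  have nS' : n%:R ^+ 2 <= #|` S|%:R :> R by rewrite -natrX ler_nat.
  have pS' : 2 * (size p)%:R <= 5 * #|` S|%:R + d%:R * (n%:R + 1) :> R.
    by rewrite natr1 -!natrM -natrD ler_nat.
  have n1 : 1 <= n%:R :> R by rewrite ler1n.
  have d0 : 0 <= d%:R :> R by rewrite ler0n.
  nra.
split=> // -[A [genA TS]].
have [k0 dk0] := generates_dist (thompson_x 0) genA.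
have [k1 dk1] := generates_dist (thompson_x 1) genA.
pose K := (k0 + k1)%N.
have dK b : b \in [fset thompson_x 0; thompson_x 1] -> dist_le A b K.
  rewrite !inE => /orP[]/eqP->.
    by apply: tours_sub dk0 => //; exact: leq_addr.
  by apply: tours_sub dk1 => //; exact: leq_addl.
(* Any ratio above 5/2 would do; with 3, a path in the standard Cayley graph
   translates to a ratio at most 3 K for the generating set A. *)
have [|xi xiP] := TS (3 * K%:R + 1); first by rewrite ltr_wpDl ?mulr_ge0.
have [|S [rS [v [p [cp vS pS]]]]] := short 3 _ xi; first by lra.
have S0 : (0 < #|` S|)%N.
  by rewrite lt0n; apply/eqP => S0; move: pS; rewrite S0 mulr0 ltNge ler0n.
have := xiP S; rewrite -cardfs_eq0 -lt0n => /(_ S0 rS); apply/negP.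
case/andP: cp => pp /eqP lp.
have [q [pq lq sq qS]] := tours_change dK pp.
have : closed_visit_length (cayley A) S (size q).
  exists v, q; split=> //; first by rewrite /closed_path pq lq lp eqxx.
  by move=> g /vS/qS.
move=> /shortest_length_le/leq_trans/(_ sq); rewrite -(ler_nat R) natrM => sh.
rewrite -ltNge /tau ltr_pdivrMr ?ltr0n //; apply: le_lt_trans sh _.
have K0 : 0 <= K%:R :> R by rewrite ler0n.
have S0' : 0 < #|` S|%:R :> R by rewrite ltr0n.
nra.
Qed.
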